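(* Let $A\in\mathbb{C}^{n\times n}$ be given by a Hartwig–Spindelböck decomposition and let $X$ be a minimal rank weak Drazin inverse of $A$. If $Y=A^{\dagger}AXAA^{\dagger}$, then the following statements are equivalent: (1) $Y=A^{\dagger}$; (2) $\operatorname{ind}(A)\le 1$; (3) $A=AA^{D}A$; (4) $A=XA^{2}$; (5) $X$ is a $\chi$-inverse of $A$.
   Context: $A^{\dagger}$ is the Moore–Penrose inverse of $A$ and $\mathcal{R}(\cdot)$ denotes the range. The index $\operatorname{ind}(A)$ is the smallest nonnegative integer $k$ such that $\operatorname{rank}(A^k)=\operatorname{rank}(A^{k+1})$. $A^{D}$ is the Drazin inverse of $A$: the unique $T$ with $TAT=T$, $AT=TA$, $A^{k+1}T=A^k$ where $k=\operatorname{ind}(A)$. A matrix $X\in\mathbb{C}^{n\times n}$ is a minimal rank weak Drazin inverse of $A$ if $XA^{k+1}=A^{k}$ for some $k\in\mathbb{N}$ and $\operatorname{rank}(X)=\operatorname{rank}(A^{D})$. For a fixed such $X$, $A^{\dagger}AXAA^{\dagger}$ is called the weak CMP inverse of $A$. A matrix $X\in\mathbb{C}^{n\times n}$ is a $\chi$-inverse of $A$ if $AXA=A$ and $\mathcal{R}(X)\subseteq\mathcal{R}(A)$. Hartwig–Spindelböck decomposition: every $A\in\mathbb{C}^{n\times n}$ of rank $r$ can be written as $A=U\begin{bmatrix}\Sigma K&\Sigma L\\0&0\end{bmatrix}U^{*}$, where $U\in\mathbb{C}^{n\times n}$ is unitary, $\Sigma=\operatorname{diag}(\sigma_1I_{r_1},\ldots,\sigma_tI_{r_t})$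 is the diagonal matrix of (nonzero) singular values of $A$, $\sigma_1>\cdots>\sigma_t>0$, $r_1+\cdots+r_t=r$, and $K\in\mathbb{C}^{r\times r}$, $L\in\mathbb{C}^{r\times(n-r)}$ satisfy $KK^{*}+LL^{*}=I_r$. *)

(* Defs.v *)
From mathcomp Require Import all_boot all_order all_algebra.
From mathcomp Require Import classical_sets reals.
From mathcomp.real_closed Require Import complex.

Set Implicit Arguments.
Unset Strict Implicit.
Unset Printing Implicit Defensive.

Import Order.TTheory GRing.Theory Num.Theory.
Local Open Scope ring_scope.
Local Open Scope sesquilinear_scope.

Section MoorePenrose.
Variable C : numClosedFieldType.
Implicit Types m n : nat.

Definition is_mpinv m n (A : 'M[C]_(m, n)) (X : 'M[C]_(n, m)) : bool :=
  [&& A *m X *m A == A, X *m A *m X == X,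
      (A *m X)^t* == A *m X & (X *m A)^t* == X *m A].

Lemma trCM m n p (A : 'M[C]_(m, n)) (B : 'M[C]_(n, p)) :
  (A *m B)^t* = B^t* *m A^t*.
Proof. by rewrite trmx_mul map_mxM. Qed.

Lemma gram_row_eq0 n (u : 'rV[C]_n) : u *m u^t* = 0 -> u = 0.
Proof.
move=> /matrixP/(_ 0 0); rewrite !mxE => /eqP.
rewrite psumr_eq0; last by move=> j _; rewrite !mxE -normCK exprn_ge0.
move=> /allP u0; apply/rowP => j; rewrite !mxE.
have /= := u0 j (mem_index_enum j).
by rewrite !mxE -normCK expf_eq0 normr_eq0 => /eqP.
Qed.

Lemma gram_unit m n (G : 'M[C]_(m, n)) : row_free G -> G *m G^t* \in unitmx.
Proof.
move=> freeG; rewrite -row_free_unit -kermx_eq0.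
apply/eqP/row_matrixP => i; rewrite row0.
set v := row i _.
have v0 : v *m (G *m G^t*) = 0.
  by rewrite -row_mul mulmx_ker row0.
have vG0 : v *m G = 0.
  by apply: gram_row_eq0; rewrite trCM mulmxA -[v *m G *m _]mulmxA v0 mul0mx.
by apply: (row_free_inj freeG); rewrite vG0 mul0mx.
Qed.

Lemma mpinv_exists m n (A : 'M[C]_(m, n)) :
  exists X : 'M[C]_(n, m), is_mpinv A X.
Proof.
have := mulmx_base A; move: (col_base_full A) (row_base_free A).
move: (\rank A) (col_base A) (row_base A) => r F G fullF freeG /esym AE.
have uG : G *m G^t* \in unitmx by apply: gram_unit.
have uF : F^t* *m F \in unitmx.
  rewrite -[X in _ *m X]trmxCK; apply: gram_unit.
  by rewrite /row_free mxrank_map mxrank_tr.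
set P := G *m G^t* in uG; set Q := F^t* *m F in uF.
have Ph : (invmx P)^t* = invmx P.
  by rewrite trmx_inv map_invmx /P trCM trmxCK.
have Qh : (invmx Q)^t* = invmx Q.
  by rewrite trmx_inv map_invmx /Q trCM trmxCK.
set X := G^t* *m invmx P *m invmx Q *m F^t*.
have AX : A *m X = F *m invmx Q *m F^t*.
  by rewrite AE /X !mulmxA -(mulmxA F G) -/P mulmxK.
have XA : X *m A = G^t* *m invmx P *m G.
  by rewrite AE /X !mulmxA -(mulmxA _ _ F) -/Q mulmxKV.
exists X; apply/and4P; split; apply/eqP.
- by rewrite AX AE !mulmxA -(mulmxA _ _ F) -/Q mulmxKV.
- by rewrite XA /X !mulmxA -(mulmxA _ G) -/P mulmxKV.
- by rewrite AX !trCM Qh trmxCK mulmxA.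
- by rewrite XA !trCM Ph trmxCK mulmxA.
Qed.

Definition mpinv m n (A : 'M[C]_(m, n)) : 'M[C]_(n, m) :=
  xchoose (mpinv_exists A).

Lemma mpinvP m n (A : 'M[C]_(m, n)) : is_mpinv A (mpinv A).
Proof. exact: xchooseP (mpinv_exists A). Qed.

Lemma mpinv_uniq m n (A : 'M[C]_(m, n)) (X : 'M[C]_(n, m)) :
  is_mpinv A X -> X = mpinv A.
Proof.
have /and4P[/eqP y1 /eqP y2 /eqP y3 /eqP y4] := mpinvP A.
move: (mpinv A) y1 y2 y3 y4 => Y y1 y2 y3 y4.
case/and4P=> /eqP x1 /eqP x2 /eqP x3 /eqP x4.
have AXY : A *m X = A *m Y.
  by rewrite -[LHS]x3 -{1}y1 -[A *m Y *m A *m X]mulmxA trCM x3 y3 mulmxA x1.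
have XAY : X *m A = Y *m A.
  rewrite -[LHS]x4 -{1}y1 -[A *m Y *m A]mulmxA mulmxA trCM x4 y4.
  by rewrite -mulmxA (mulmxA A) x1.
by rewrite -x2 XAY -mulmxA AXY mulmxA y2.
Qed.

End MoorePenrose.

Section Drazin.
Variables (F : fieldType) (n : nat).
Implicit Types A T X : 'M[F]_n.

Lemma ind_exists A : exists k, \rank (A ^+ k) == \rank (A ^+ k.+1).
Proof.
have dec k : (\rank (A ^+ k.+1) <= \rank (A ^+ k))%N.
  by rewrite exprS; apply: mxrankM_maxr.
have [/existsP[k kP]|] := boolP [exists k : 'I_n.+1,
    \rank (A ^+ k) == \rank (A ^+ k.+1)]; first by exists k.
rewrite negb_exists => /forallP H.
have bound k : (k <= n.+1)%N -> (\rank (A ^+ k) + k <= n)%N.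
  elim: k => [_|k IHk kn]; first by rewrite addn0 rank_leq_row.
  rewrite addnS (leq_trans _ (IHk (ltnW kn))) // -addSn leq_add2r.
  by rewrite ltn_neqAle dec eq_sym (H (Ordinal kn)).
by have := bound n.+1 (leqnn _); rewrite addnS ltnNge leq_addl.
Qed.

Definition ind A : nat := ex_minn (ind_exists A).

Definition is_drazin A T : bool :=
  [&& T *m A *m T == T, A *m T == T *m A
    & A ^+ (ind A).+1 *m T == A ^+ ind A].

Lemma drazin_exists A : exists T, is_drazin A T.
Proof.
rewrite /is_drazin; set k := ind A.
have rk : \rank (A ^+ k) = \rank (A ^+ k.+1).
  by rewrite /k /ind; case: ex_minnP => i /eqP.
have [D AD] : exists D, A ^+ k = D * A ^+ k.+1.
  apply/submxP; rewrite -(geq_leqif (mxrank_leqif_sup _)) ?rk //.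
  by rewrite exprS submxMl.
have [E AE] : exists E, A ^+ k = A ^+ k.+1 * E.
  have /submxP[E0 HE] : ((A ^+ k)^T <= (A ^+ k.+1)^T)%MS.
    rewrite -(geq_leqif (mxrank_leqif_sup _)) ?mxrank_tr ?rk //.
    by rewrite exprSr trmx_mul submxMl.
  by exists E0^T; rewrite -[LHS]trmxK HE trmx_mul trmxK.
have [W AW] : exists W, A ^+ k = W * A ^+ (k.+1 + k).
  have [W HW] : exists W, A ^+ k = W * A ^+ (k + k.+1).
    elim: k.+1 => [|j [W HW]]; first by exists 1; rewrite addn0 mul1r.
    by exists (W * D); rewrite addnS -addSn exprD -mulrA (mulrA D) -AD -exprD.
  by exists W; rewrite addnC.
have [V AV] : exists V, A ^+ k = A ^+ (k.+1 + k) * V.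
  elim: k.+1 => [|j [V HV]]; first by exists 1; rewrite mulr1.
  by exists (E * V); rewrite addSnnS exprD mulrA -(mulrA (A ^+ j)) -AE -exprD.
have WV : W * A ^+ k = A ^+ k * V by rewrite {1}AV mulrA -AW.
have T1 : A * (A ^+ k * V) = W * A ^+ k * A.
  have cA j : A ^+ j * A = A * A ^+ j by rewrite -exprS exprSr.
  by rewrite mulrA -cA {1}AW -(mulrA W) cA -!mulrA -AV cA.
exists (A ^+ k * V); apply/and3P; split; apply/eqP; rewrite -!mulmxE.
- rewrite -[RHS]WV {1}[A ^+ k *m V](esym WV) [in RHS]AV.
  by rewrite !mulmxE -!mulrA (mulrA A) -exprS (mulrA (A ^+ k)) -exprD addnC.
- by rewrite !mulmxE T1 WV.
- by rewrite !mulmxE mulrA -exprD -AV.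
Qed.

Definition drazin A : 'M[F]_n := xchoose (drazin_exists A).

Lemma drazinP A : is_drazin A (drazin A).
Proof. exact: xchooseP (drazin_exists A). Qed.

Lemma drazin_uniq A T : is_drazin A T -> T = drazin A.
Proof.
have /and3P[/eqP s1 /eqP s2 /eqP s3] := drazinP A.
move: (drazin A) s1 s2 s3 => S; rewrite !mulmxE => s1 s2 s3.
case/and3P=> /eqP; rewrite !mulmxE => t1 /eqP t2 /eqP t3.
set k := ind A in s3 t3.
have TE j : T = T ^+ j.+1 * A ^+ j.
  elim: j => [|j IHj]; first by rewrite mulr1.
  rewrite [T ^+ _]exprS [A ^+ _]exprSr -mulrA (mulrA (T ^+ _)) -IHj -t2.
  by rewrite mulrA t1.
have SE j : S = A ^+ j * S ^+ j.+1.
  elim: j => [|j IHj]; first by rewrite mul1r.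
  rewrite [A ^+ _]exprS [S ^+ _]exprSr -mulrA (mulrA (A ^+ _)) -IHj.
  by rewrite mulrA s2 s1.
have TAS : T = T * A * S.
  by rewrite {1}(TE k) -s3 [A ^+ _]exprSr !mulrA -TE.
rewrite [RHS](SE k) -t3 -(commrX k.+1 (esym t2)) exprS -!mulrA -SE mulrA.
exact: TAS.
Qed.

Definition is_min_rank_weak_drazin A X : Prop :=
  (exists k : nat, X *m A ^+ k.+1 = A ^+ k) /\ \rank X = \rank (drazin A).

(* Column space, whereas [(_ <= _)%MS] compares row spaces. *)
Definition mxrange A : set 'cV[F]_n := range (fun v : 'cV[F]_n => A *m v).

Definition is_chi_inverse A X : Prop :=
  A *m X *m A = A /\ (mxrange X `<=` mxrange A)%classic.

End Drazin.

Section HartwigSpindelboeck.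
Variable R : realType.
Local Open Scope complex_scope.

(* Multiplicity of [x >= 0] as a singular value of [A]. *)
Definition sv_mult n (A : 'M[R[i]]_n) (x : R) : nat :=
  \rank (eigenspace (A^t* *m A) (x ^+ 2)%:C).

(* [p i] is the multiplicity r_i of the i-th singular value [s i], the rank r is
   [\sum_i p i], and [m] stands for n - r; [hn] only serves to view the block
   matrix as an n x n one. *)
Definition hartwig_spindelboeck (n t m : nat) (p : 'I_t -> nat)
    (hn : ((\sum_(i < t) p i) + m = n)%N) (A U : 'M[R[i]]_n) (s : 'I_t -> R)
    (K : 'M[R[i]]_(\sum_(i < t) p i)) (L : 'M[R[i]]_(\sum_(i < t) p i, m))
    : Prop :=
  let Sigma : 'M[R[i]]_(\sum_(i < t) p i) :=
    \mxdiag_(i < t) ((s i)%:C%:M : 'M[R[i]]_(p i)) in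
  [/\ [/\ \rank A = (\sum_(i < t) p i)%N,
          (forall i, 0 < p i)%N,
          (forall i, 0 < s i),
          (forall i j : 'I_t, (i < j)%N -> s j < s i)
        & (forall x : R, 0 < x ->
             sv_mult A x = (\sum_(i < t | s i == x) p i)%N)],
      U \is unitarymx,
      K *m K^t* + L *m L^t* = 1%:M
    & A = U *m castmx (hn, hn) (block_mx (Sigma *m K) (Sigma *m L) 0 0)
            *m U^t*].

End HartwigSpindelboeck.

(* Main.v *)
(* Write D for the Drazin inverse. A minimal rank weak Drazin inverse X satisfies
   X A^2 D = A D, so the range of X contains that of D; the ranks being equal, the
   ranges agree and hence X = A D X. These two identities give the whole cycle of
   implications. *)
Require Import Defs.
From mathcomp Require Import all_boot all_order all_algebra.
From mathcomp Require Import classical_sets reals.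
From mathcomp.real_closed Require Import complex.

Import Order.TTheory GRing.Theory Num.Theory.
Local Open Scope ring_scope.

Section WeakDrazin.
Variables (F : fieldType) (n : nat).
Implicit Types A X : 'M[F]_n.

Lemma drazin_mulK A : drazin A * A * drazin A = drazin A.
Proof. by have /and3P[/eqP] := drazinP A. Qed.

Lemma drazin_comm A : A * drazin A = drazin A * A.
Proof. by have /and3P[_ /eqP] := drazinP A. Qed.

Lemma drazin_exp A k : A ^+ k.+1 * drazin A ^+ k.+1 = A * drazin A.
Proof.
elim: k => [|k IHk]; first by rewrite !expr1.
rewrite exprS [drazin A ^+ _]exprSr mulrA -(mulrA A) IHk.
by rewrite drazin_comm -mulrA drazin_mulK drazin_comm.
Qed.

(** Expanding [A * drazin A] as [A ^+ k.+1 * drazin A ^+ k.+1] produces the very power that [X]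
    lowers to [A ^+ k]; commuting a leftover [A] past the powers of [drazin A] restores the
    exponent. *)
Lemma weak_drazin_core A X k :
  X * A ^+ k.+1 = A ^+ k -> X * A * A * drazin A = A * drazin A.
Proof.
move=> XA; have cD : GRing.comm A (drazin A ^+ k.+1).
  exact: commrX (drazin_comm A).
rewrite -(mulrA _ A) {1}drazin_comm mulrA -(mulrA X) -(drazin_exp A k) mulrA XA.
by rewrite -mulrA -cD mulrA -exprSr drazin_exp.
Qed.

Lemma min_rank_weak_drazin_core A X :
  is_min_rank_weak_drazin A X -> X * A * A * drazin A = A * drazin A.
Proof. by case=> -[k /weak_drazin_core]. Qed.

Lemma min_rank_weak_drazin_range A X :
  is_min_rank_weak_drazin A X -> A * drazin A * X = X.
Proof.
move=> hX; have core := min_rank_weak_drazin_core _ _ hX.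
(* Transposes turn column spaces into row spaces. The witness comes from multiplying [core] by
   [drazin A] on the right, which leaves [drazin A]. *)
have DX : ((drazin A)^T <= X^T)%MS.
  apply/submxP; exists (A * A * drazin A * drazin A)^T.
  rewrite -trmx_mul mulmxE !mulrA core drazin_comm.
  by rewrite drazin_mulK.
have /submxP[W XW] : (X^T <= (drazin A)^T)%MS.
  by rewrite -(geq_leqif (mxrank_leqif_sup DX)) !mxrank_tr; case: hX => _ ->.
have -> : X = drazin A * W^T.
  by rewrite -[LHS]trmxK XW trmx_mul trmxK.
by rewrite mulrA drazin_comm drazin_mulK.
Qed.

Lemma ind_le1 A : \rank A = \rank (A ^+ 2) -> (ind A <= 1)%N.
Proof.
by move=> rA; rewrite /ind; case: ex_minnP => k _; apply; rewrite expr1 rA.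
Qed.

Lemma ind_le1_drazin A : (ind A <= 1)%N -> A * drazin A * A = A.
Proof.
have /and3P[_ _ /eqP] := drazinP A; rewrite mulmxE.
case: (ind A) => [|[|//]] /= AD _.
  (* At index 0 the equation [AD] says that [A * drazin A] is the identity. *)
  by rewrite -[in A * drazin A](expr1 A) AD mul1r.
by rewrite -mulrA -drazin_comm mulrA -expr2 AD.
Qed.

End WeakDrazin.

Theorem proposition3p1 (R : realType) (n t m : nat) (p : 'I_t -> nat)
    (hn : ((\sum_(i < t) p i) + m = n)%N) (A U : 'M[R[i]]_n) (s : 'I_t -> R)
    (K : 'M[R[i]]_(\sum_(i < t) p i)) (L : 'M[R[i]]_(\sum_(i < t) p i, m))
    (hA : hartwig_spindelboeck hn A U s K L)
    (X : 'M[R[i]]_n) (hX : is_min_rank_weak_drazin A X)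
    (Y : 'M[R[i]]_n) (hY : Y = mpinv A *m A *m X *m A *m mpinv A) :
  [<-> Y = mpinv A;
       (ind A <= 1)%N;
       A = A *m drazin A *m A;
       A = X *m A ^+ 2;
       is_chi_inverse A X].
Proof.
have core := min_rank_weak_drazin_core _ _ _ _ hX.
have XE := min_rank_weak_drazin_range _ _ _ _ hX.
have /and4P[/eqP AMA /eqP MAM _ _] := mpinvP A.
tfae.
(* Multiplying [Y = mpinv A] by [A] on both sides absorbs every factor [mpinv A]. *)
- move=> YM; have AXA : A * X * A = A.
    rewrite -[RHS]AMA -YM hY !mulmxA AMA.
    by rewrite -!(mulmxA (A *m X)) AMA.
  apply: ind_le1; apply/eqP; rewrite eqn_leq; apply/andP; split.
    (* With [XE], [AXA] factors [A] as [A ^+ 2 * (drazin A * X * A)]. *)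
    by rewrite -{1}AXA -XE -!mulrA (mulrA A A) -expr2; apply: mxrankM_maxl.
  by rewrite expr2; apply: mxrankM_maxl.
- by move=> /ind_le1_drazin.
- rewrite !mulmxE => AE.
  by rewrite expr2 [LHS]AE -core -!mulrA (mulrA A (drazin A)) -AE.
- rewrite mulmxE => AE.
  (* Left multiplication by [A * drazin A] fixes [X], hence also [X * A ^+ 2], which is [A]. *)
  have ADA : A * drazin A * A = A by rewrite {3 4}AE mulrA XE.
  have AAD : A * (A * drazin A) = A by rewrite drazin_comm mulrA.
  split; first by rewrite !mulmxE -[RHS]AAD -core -!mulrA AAD.
  (* The preimage is read off [XE]. *)
  move=> _ [v _ <-]; exists (drazin A *m X *m v) => //.
  by rewrite !mulmxA [A *m _ *m X]XE.
- by case=> AXA _; rewrite hY -(mulmxA _ X) -(mulmxA _ A) (mulmxA A X) AXA MAM.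
Qed.
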